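(* Let $\alpha \in \mathcal{C}_{\delta}$ be a dependency generator. Then for any $n \in \mathbb{N}$ with $n \geq 2$, the dependent categorical random sequence $(\epsilon_1,\dots,\epsilon_n)$ generated by $\alpha$ has identically distributed elements; that is, $\epsilon_1,\dots,\epsilon_n$ all have the same distribution on $\{1,\dots,K\}$.
   Context: Fix a number of categories $K \in \mathbb{N}$, probabilities $p_1,\dots,p_K \geq 0$ with $\sum_{i=1}^K p_i = 1$, and a dependency coefficient $0 \leq \delta \leq 1$. Put $p_j^{+} = p_j + \delta(1-p_j)$ and $p_j^{-} = p_j - \delta p_j$ for $j = 1,\dots,K$. The class of dependency generators $\mathcal{C}_{\delta}$ is the set of functions $\alpha : \mathbb{N}_{\geq 2} \to \mathbb{N}$ such that, for all $n \ge 2$, $\alpha(n) < n$ and there exists $j \in \{1,\dots,n-1\}$ with $\alpha(n) = j$ (the latter property is called dependency continuity). Equivalently, $1 \leq \alpha(n) < n$ for all $n\ge 2$. The dependent categorical random sequence $(\epsilon_1,\dots,\epsilon_n)$ generated by $\alpha$ takes values in $\{1,\dots,K\}^n$. Here $P(\epsilon_1 = i) = p_i$, and for each $2 \leq l \leq n$ the variable $\epsilon_l$ depends directly only on $\epsilon_{\alpha(l)}$: $P(\epsilon_l \mid \epsilon_{l-1},\dots,\epsilon_1) = P(\epsilon_l \mid \epsilon_{\alpha(l)})$, with $P(\epsilon_l = j \mid \epsilon_{\alpha(l)} = j) = p_j^{+}$ and $P(\epsilon_l = j \mid \epsilon_{\alpha(l)} = i) = p_j^{-}$ for $i \neq j$.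 Equivalently, for $\omega \in \{1,\dots,K\}^n$, $$P\big((\epsilon_1,\dots,\epsilon_n) = \omega\big) = p_{\omega_1}\prod_{l=2}^{n} t(\omega_{\alpha(l)},\omega_l),$$ where $t(j,j) = p_j^{+}$ and $t(i,j) = p_j^{-}$ for $i \neq j$. *)

(* Defs.v *)
From HB Require Import structures.
From mathcomp Require Import all_boot all_order all_algebra.
From mathcomp Require Import all_classical all_reals all_analysis.

Set Implicit Arguments.
Unset Strict Implicit.
Unset Printing Implicit Defensive.

Import Order.TTheory GRing.Theory Num.Theory.

Local Open Scope classical_set_scope.
Local Open Scope ring_scope.

(* The class C_delta, which does not depend on delta.  A generator is a
   function on {2, 3, ...}; its values at 0 and 1 are irrelevant. *)
Definition dep_generators : set (nat -> nat) :=
  [set alpha | forall n : nat, (2 <= n)%N ->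
     (alpha n < n)%N /\ exists j : nat, (1 <= j <= n.-1)%N /\ alpha n = j].

(* Categories are the natural numbers 1, ..., K; p is only used there. *)
Definition categorical_weights (R : realType) (K : nat) (p : nat -> R) : Prop :=
  (forall i : nat, (1 <= i <= K)%N -> 0 <= p i) /\
  \sum_(1 <= i < K.+1) p i = 1.

Definition p_plus (R : realType) (p : nat -> R) (delta : R) (j : nat) : R :=
  p j + delta * (1 - p j).

Definition p_minus (R : realType) (p : nat -> R) (delta : R) (j : nat) : R :=
  p j - delta * p j.

Definition transition (R : realType) (p : nat -> R) (delta : R) (i j : nat) : R :=
  if i == j then p_plus p delta j else p_minus p delta j.

(* P(A | B); only meaningful when P(B) > 0. *)
Definition cond_prob d (T : measurableType d) (R : realType)
    (P : probability T R) (A B : set T) : R :=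
  fine (P (A `&` B)) / fine (P B).

Section dependent_categorical_sequence.
Context d (T : measurableType d) (R : realType) (P : probability T R).
Implicit Types (eps : nat -> {RV P >-> nat}) (omega : nat -> nat).

Definition value_event eps (l i : nat) : set T := [set x | eps l x = i].

(* The event eps_1 = omega_1, ..., eps_(l-1) = omega_(l-1). *)
Definition history_event eps omega (l : nat) : set T :=
  [set x | forall k : nat, (1 <= k < l)%N -> eps k x = omega k].

(* The sequence is (eps 1, ..., eps n); the other terms of eps are
   unconstrained.  Conditional probabilities are prescribed only given events
   of positive probability, since some p_i may vanish. *)
Record dependent_categorical (K : nat) (p : nat -> R) (delta : R)
    (alpha : nat -> nat) (n : nat) eps : Prop := DependentCategorical {
  dc_range : forall l : nat, (1 <= l <= n)%N ->
    forall x : T, (1 <= eps l x <= K)%N;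
  dc_initial : forall i : nat, (1 <= i <= K)%N ->
    P (value_event eps 1 i) = (p i)%:E;
  dc_dependence : forall (l : nat) (omega : nat -> nat), (2 <= l <= n)%N ->
    (forall k : nat, (1 <= k <= l)%N -> (1 <= omega k <= K)%N) ->
    (0 < P (history_event eps omega l))%E ->
    cond_prob P (value_event eps l (omega l)) (history_event eps omega l) =
    cond_prob P (value_event eps l (omega l))
                (value_event eps (alpha l) (omega (alpha l)));
  dc_transition : forall l i j : nat, (2 <= l <= n)%N ->
    (1 <= i <= K)%N -> (1 <= j <= K)%N ->
    (0 < P (value_event eps (alpha l) i))%E ->
    cond_prob P (value_event eps l j) (value_event eps (alpha l) i) =
    transition p delta i j
}.

End dependent_categorical_sequence.

(* Main.v *)
Require Import Defs.
From mathcomp Require Import all_boot all_order all_algebra.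
From mathcomp Require Import all_classical all_reals all_analysis.
From mathcomp Require Import ring.

(* The transition matrix is (1 - delta) (1 p^T) + delta I, hence it leaves the
   vector p invariant.  As alpha l < l, strong induction on l gives
   P(eps_l = j) = p_j for every l. *)

Set Implicit Arguments.
Unset Strict Implicit.
Unset Printing Implicit Defensive.

Import Order.TTheory GRing.Theory Num.Theory.

Local Open Scope classical_set_scope.
Local Open Scope ring_scope.

(** For [delta] in [0, 1], one step is a mixture: with weight [delta] the new variable copies its
    parent, with weight [1 - delta] it is drawn afresh from [p]. Both moves preserve the law [p]
    ([transition_invariant]). Conditioning [eps l] on the value of its parent [eps (alpha l)], which
    has law [p] by induction, therefore gives law [p] again ([dependent_categorical_marginal]).
    Point masses on 1, ..., K determine the whole law ([eq_distribution_nat]). *)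

Lemma transitionE (R : realType) (p : nat -> R) (delta : R) (i j : nat) :
  transition p delta i j = (1 - delta) * p j + delta * (i == j)%:R.
Proof. by rewrite /transition /p_plus /p_minus; case: eqP => _ /=; ring. Qed.

(** The fresh-draw part contributes [(1 - delta) * p j] times the total mass 1; of the copying part
    only the diagonal term [delta * p j] survives. *)
Lemma transition_invariant (R : realType) (K : nat) (p : nat -> R) (delta : R)
    (j : nat) : \sum_(1 <= i < K.+1) p i = 1 -> (1 <= j <= K)%N ->
  \sum_(1 <= i < K.+1) transition p delta i j * p i = p j.
Proof.
move=> sum_p j_range.
under eq_bigr do rewrite transitionE mulrDl.
rewrite big_split /= -mulr_sumr sum_p (bigD1_seq j) /= ?iota_uniq//; last first.
  by rewrite mem_index_iota ltnS.
rewrite big1 => [|i /negbTE ->]; last by rewrite mulr0 mul0r.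
by rewrite eqxx /=; ring.
Qed.

Section finite_range.
Context (d : measure_display) (T : measurableType d) (R : realType).
Context (P : probability T R) (K : nat).
Implicit Types X Y : {RV P >-> nat}.

Lemma measurable_preimage_nat X (A : set nat) : measurable (X @^-1` A).
Proof. exact: measurable_funPTI. Qed.

(** The range hypothesis holds at every point, so the level sets of [X] at 1, ..., K partition the
    whole space and finite additivity applies. *)
Lemma total_probability X (B : set T) :
  (forall x, 1 <= X x <= K)%N -> measurable B ->
  P B = (\sum_(1 <= i < K.+1) P (B `&` X @^-1` [set i]))%E.
Proof.
move=> X_range mB; rewrite big_add1 big_mkord /=.
rewrite -(measure_bigsetU P (F := fun i => B `&` X @^-1` [set i.+1])).
- rewrite -(bigcup_mkord K (fun i => B `&` X @^-1` [set i.+1])).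
  rewrite -setI_bigcupr; congr (P _).
  (* After the shift, index [i] stands for the value [i.+1], so [x] lies in the cell of index
     [(X x).-1]; [1 <= X x] makes the predecessor exact. *)
  apply/esym/setIidPl => x _; exists (X x).-1 => /=;
  by case/andP: (X_range x) => /prednK ->.
- by move=> i; apply: measurableI => //; exact: measurable_preimage_nat.
- apply/trivIsetP => i j _ _ /eqP ij; rewrite -subset0 => x.
  by case=> -[_ /= ->] [_ [/ij]].
Qed.

(** Split the preimage of [A] along the level sets: each piece is either a full level set or empty,
    according to whether [i] belongs to [A]. *)
Lemma eq_distribution_nat X Y :
  (forall x, 1 <= X x <= K)%N -> (forall x, 1 <= Y x <= K)%N ->
  (forall i, (1 <= i <= K)%N ->
     P (X @^-1` [set i]) = P (Y @^-1` [set i])) ->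
  distribution P X = distribution P Y.
Proof.
move=> X_range Y_range XY; apply/funext => A; rewrite /distribution /pushforward.
rewrite (total_probability X_range (measurable_preimage_nat X A)).
rewrite (total_probability Y_range (measurable_preimage_nat Y A)).
apply: eq_big_nat => i; rewrite ltnS -!preimage_setI => i_range.
have [Ai|nAi] := pselect (A i).
  have /setIidPr -> : [set i] `<=` A by move=> _ ->.
  exact: XY.
have -> : A `&` [set i] = set0 by rewrite -subset0 => k /= [] /[swap] ->.
by rewrite !preimage_set0 !measure0.
Qed.

End finite_range.

Lemma dependent_categorical_marginal (R : realType) (K : nat) (p : nat -> R)
    (delta : R) (alpha : nat -> nat) (n : nat) (d : measure_display)
    (T : measurableType d) (P : probability T R) (eps : nat -> {RV P >-> nat}) :
  categorical_weights K p -> dep_generators alpha ->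
  dependent_categorical K p delta alpha n eps ->
  forall l j : nat, (1 <= l <= n)%N -> (1 <= j <= K)%N ->
    P (value_event eps l j) = (p j)%:E.
Proof.
move=> [p_ge0 sum_p] alphaC [eps_range init _ trans].
(* Strong induction, since the parent [alpha l] may be any earlier index. *)
elim/ltn_ind => l IH j l_range j_range.
have [l_le1|l_gt1] := leqP l 1.
  have -> : l = 1%N by apply/eqP; rewrite eqn_leq l_le1; case/andP: l_range.
  exact: init.
have [lt_alpha [k [k_range alphaE]]] := alphaC _ l_gt1.
have {k alphaE k_range} alpha_range : (1 <= alpha l <= n)%N.
  case/andP: k_range l_range => k_gt0 _ /andP[_ l_len].
  by rewrite alphaE k_gt0 -alphaE (leq_trans (ltnW lt_alpha)).
have mE k i : measurable (value_event eps k i).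
  exact: (measurable_preimage_nat (eps k) [set i]).
rewrite (total_probability (eps_range _ alpha_range))//.
rewrite -(transition_invariant delta sum_p j_range) -sumEFin.
apply: eq_big_nat => i; rewrite ltnS => i_range.
have Pi := IH _ lt_alpha _ alpha_range i_range.
rewrite -[X in P (_ `&` X)]/(value_event eps (alpha l) i).
(* If [p i = 0], the conditional probability is a quotient by zero and [trans] does not apply; the
   joint event is then null, being contained in the null event that the parent equals [i]. *)
have := p_ge0 i i_range; rewrite le_eqVlt => /orP[/eqP pi0|pi_gt0].
  rewrite -pi0 mulr0.
  apply: (@subset_measure0 _ _ _ P _ (value_event eps (alpha l) i)) => //.
  - exact: measurableI.
  - by rewrite [LHS]Pi -pi0.
(* Here [p i > 0], so the transition weight is a genuine quotient whose denominator [p i] cancels,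
   leaving the joint probability. *)
rewrite -(trans l i j) ?Pi ?lte_fin//; last by rewrite l_gt1; case/andP: l_range.
rewrite /cond_prob Pi /= divfK ?gt_eqF// fineK// fin_num_measure//.
exact: measurableI.
Qed.

Theorem theorem2 (R : realType) (K : nat) (p : nat -> R) (delta : R)
    (hp : categorical_weights K p) (hdelta : 0 <= delta <= 1)
    (alpha : nat -> nat) (halpha : alpha \in dep_generators)
    (n : nat) (hn : (2 <= n)%N)
    (d : measure_display) (T : measurableType d) (P : probability T R)
    (eps : nat -> {RV P >-> nat})
    (heps : dependent_categorical K p delta alpha n eps) :
  forall l m : nat, (1 <= l <= n)%N -> (1 <= m <= n)%N ->
    distribution P (eps l) = distribution P (eps m).
Proof.
move=> l m l_range m_range; move: halpha; rewrite inE => alphaC.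
apply: (@eq_distribution_nat _ _ _ _ K).
- exact: (dc_range heps).
- exact: (dc_range heps).
- move=> i i_range; have marginal := dependent_categorical_marginal hp alphaC heps.
  by rewrite [LHS](marginal l i)// [RHS](marginal m i).
Qed.
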